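(* (1) If $\Pi_\lambda$ is the left representation of an LC-loop and $\beta\in\Pi_\lambda$, then $\beta^n\in\Pi_\lambda$ for all $n\in\mathbb{Z}$. (2) If $\Pi_\rho$ is the right representation of an RC-loop and $\beta\in\Pi_\rho$, then $\beta^n\in\Pi_\rho$ for all $n\in\mathbb{Z}$.
   Context: A loop is a quasigroup with a two-sided identity element. For $x$ in a loop $L$, the translations $L_x,R_x:L\to L$ are the bijections $yL_x=xy$ and $yR_x=yx$. The left representation of $L$ is $\Pi_\lambda=\{L_x : x\in L\}$ and the right representation is $\Pi_\rho=\{R_x : x\in L\}$. Powers $\beta^n$ are taken in the group of all bijections of $L$ under composition. $L$ is an LC-loop if $(xx)(yz)=(x(xy))z$ for all $x,y,z\in L$, and an RC-loop if $(zy)(xx)=z((yx)x)$ for all $x,y,z\in L$. *)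

(* Defs.v *)
From HB Require Import structures.
From mathcomp Require Import all_boot all_order all_algebra.
From mathcomp Require Import boolp classical_sets.

Set Implicit Arguments.
Unset Strict Implicit.
Unset Printing Implicit Defensive.

Local Open Scope group_scope.

HB.mixin Record isQuasigroup Q of Magma Q := {
  quasigroup_ldiv : forall a b : Q, exists! x : Q, a * x = b;
  quasigroup_rdiv : forall a b : Q, exists! y : Q, y * a = b
}.

#[short(type="loopType")]
HB.structure Definition Loop := {L of UMagma L & isQuasigroup L}.

Record bijection (T : Type) := Bijection {
  bij_fun :> T -> T;
  bij_funP : bijective bij_fun
}.

Section BijectionGroup.
Variable T : Type.
Implicit Types f g h : bijection T.

Lemma bijectionP f g : f =1 g -> f = g.
Proof.
case: f g => [f fP] [g gP] /= /funext fg; rewrite fg in fP *.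
by congr Bijection; apply: Prop_irrelevance.
Qed.

Lemma bij_inv_ex f : exists g : T -> T, cancel f g /\ cancel g f.
Proof. by have [g fK gK] := bij_funP f; exists g. Qed.

Definition bij_inv_fun f : T -> T := projT1 (cid (bij_inv_ex f)).

Lemma bij_invK f : cancel f (bij_inv_fun f).
Proof. by rewrite /bij_inv_fun; case: cid => g []. Qed.

Lemma bij_invKV f : cancel (bij_inv_fun f) f.
Proof. by rewrite /bij_inv_fun; case: cid => g []. Qed.

Definition bij_id : bijection T :=
  @Bijection T id (Bijective (fun=> erefl) (fun=> erefl)).

(* Maps act on the right, as in y L_x: the product f * g applies f first. *)
Definition bij_mul f g : bijection T :=
  Bijection (bij_comp (bij_funP g) (bij_funP f)).

Definition bij_inv f : bijection T :=
  @Bijection T (bij_inv_fun f) (Bijective (bij_invKV f) (bij_invK f)).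

Lemma bij_mulA : associative bij_mul.
Proof. by move=> f g h; apply: bijectionP. Qed.

Lemma bij_mul1 : left_id bij_id bij_mul.
Proof. by move=> f; apply: bijectionP. Qed.

Lemma bij_mulr1 : right_id bij_id bij_mul.
Proof. by move=> f; apply: bijectionP. Qed.

Lemma bij_mulV : left_inverse bij_id bij_inv bij_mul.
Proof. by move=> f; apply: bijectionP => x /=; apply: bij_invKV. Qed.

Lemma bij_mulrV : right_inverse bij_id bij_inv bij_mul.
Proof. by move=> f; apply: bijectionP => x /=; apply: bij_invK. Qed.

HB.instance Definition _ := gen_eqMixin (bijection T).
HB.instance Definition _ := gen_choiceMixin (bijection T).
HB.instance Definition _ := isGroup.Build (bijection T)
  bij_mulA bij_mul1 bij_mulr1 bij_mulV bij_mulrV.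

End BijectionGroup.

(* [Negz m] is the integer - m.+1. *)
Definition expgz (G : groupType) (x : G) (n : int) : G :=
  match n with
  | Posz m => x ^+ m
  | Negz m => x ^- m.+1
  end.

Section Translations.
Variable L : loopType.

Lemma unique_preimage_bijective (f : L -> L) :
  (forall b, exists! x, f x = b) -> bijective f.
Proof.
move=> fP; have [g gP] := choice fP.
by exists g => x; [apply: (gP (f x)).2 | apply: (gP x).1].
Qed.

Definition left_translation (x : L) : bijection L :=
  @Bijection L (fun y => x * y) (unique_preimage_bijective (quasigroup_ldiv x)).

Definition right_translation (x : L) : bijection L :=
  @Bijection L (fun y => y * x) (unique_preimage_bijective (quasigroup_rdiv x)).

Definition left_representation : set (bijection L) := range left_translation.

Definition right_representation : set (bijection L) := range right_translation.

Definition LC_loop : Prop :=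
  forall x y z : L, (x * x) * (y * z) = (x * (x * y)) * z.

Definition RC_loop : Prop :=
  forall x y z : L, (z * y) * (x * x) = z * ((y * x) * x).

End Translations.

Arguments left_representation : clear implicits.
Arguments right_representation : clear implicits.
Arguments LC_loop : clear implicits.
Arguments RC_loop : clear implicits.

(* Main.v *)
Require Import Defs.
From mathcomp Require Import all_boot all_order all_algebra.
From mathcomp Require Import boolp classical_sets.

(** The LC (resp. RC) identity says that the translations satisfy
    [T y * T x * T x = T u] for some [u], so they form a set closed under
    [(b, a) |-> b * a * a]; starting from [1] and [a] this yields all positive
    powers of [a]. Evaluating at the identity element gives
    [u = T x (T x y)], so the choice [T x y = 1] forces
    [T y * T x * T x = T x], i.e. [T y = (T x)^-1]. *)

Local Open Scope group_scope.

Lemma expg_closed (G : groupType) (S : set G) :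
  S 1 -> (forall a b, S a -> S b -> S (b * a * a)) ->
  forall a, S a -> forall n : nat, S (a ^+ n).
Proof.
move=> S1 SM a Sa n.
(* [SM] raises the exponent by two, so the induction carries two consecutive powers. *)
suff [] : S (a ^+ n) /\ S (a ^+ n.+1) by [].
elim: n => [|n [Sn Sn1]]; first by rewrite expg0 expg1.
by split=> //; rewrite !expgSr; apply: SM.
Qed.

Section TranslationFamily.
Variables (T : Type) (e : T) (t : T -> bijection T).
Hypotheses (te : forall x, t x e = x) (t1 : t e = 1).
Hypothesis tM : forall x y, range t (t y * t x * t x).

Lemma translation_family_inv x : range t (t x)^-1.
Proof.
have [g _ gK] := bij_funP (t x).
exists (g e) => //.
have [u _ tu] := tM x (g e).
have ux : u = x by rewrite -(te u) tu /= te gK te.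
(* Multiplying by [t x] twice on the right turns both sides into [t x]. *)
apply: (mulIg (t x)); apply: (mulIg (t x)).
by rewrite -tu ux mulVg mul1g.
Qed.

(** Left and right translations are both instances of [t], with [e] the identity element. Negative
    powers of [t x] are positive powers of its inverse, itself in the family. *)
Lemma translation_family_expgz b (n : int) :
  range t b -> range t (expgz b n).
Proof.
have t_expg a m : range t a -> range t (a ^+ m).
  move=> ta; apply: expg_closed ta m; first by exists e.
  by move=> _ _ [x _ <-] [y _ <-]; apply: tM.
case=> x _ <-; case: n => m /=; first by apply: t_expg; exists x.
by rewrite -expVgn; apply/t_expg/translation_family_inv.
Qed.

End TranslationFamily.

Lemma LC_left_translationM (L : loopType) (x y : L) : LC_loop L ->
  left_translation y * left_translation x * left_translation x =
  left_translation (x * (x * y)).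
Proof.
move=> LC; apply: bijectionP => z /=.
(* LC with last factor 1 is the left alternative law [x * (x * w) = (x * x) * w], used at
   [w = y * z]. *)
by rewrite -LC -[LHS]mulg1 -LC mulg1.
Qed.

Lemma RC_right_translationM (L : loopType) (x y : L) : RC_loop L ->
  right_translation y * right_translation x * right_translation x =
  right_translation (y * x * x).
Proof.
move=> RC; apply: bijectionP => z /=.
(* Dually, RC with first factor 1 is the right alternative law, used at [z * y]. *)
by rewrite -RC -[LHS]mul1g -RC mul1g.
Qed.

Theorem theorem3p3 :
  (forall L : loopType, LC_loop L ->
     forall beta : bijection L, left_representation L beta ->
     forall n : int, left_representation L (expgz beta n)) /\
  (forall L : loopType, RC_loop L ->
     forall beta : bijection L, right_representation L beta ->
     forall n : int, right_representation L (expgz beta n)).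
Proof.
split=> L LRC b tb n.
- apply: (@translation_family_expgz L 1) tb => [x||x y].
  + exact: mulg1.
  + by apply: bijectionP => z; apply: mul1g.
  + by rewrite LC_left_translationM //; exists (x * (x * y)).
- apply: (@translation_family_expgz L 1) tb => [x||x y].
  + exact: mul1g.
  + by apply: bijectionP => z; apply: mulg1.
  + by rewrite RC_right_translationM //; exists (y * x * x).
Qed.
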